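(* Let $q$ be a prime power, let $A,B\subset\mathbb{F}_q$, and let $P=A\times B\subset\mathbb{F}_q^2$. Let $L$ be a set of lines in $\mathbb{F}_q^2$, each of the form $y=ax+b$ with $a\ne 0$, and put $L_x:=\{a : \text{the line } y=ax+b \text{ belongs to } L \text{ for some } b\}$. Assume that $|L||A|>q^{\alpha}\max\{|A|,|L_x|\}$ for some $\alpha\in(0,1)$. Then $$I(A\times B,L)\ll \frac{|L||A||B|^{1/2}}{q^{\alpha/2}}+q^{\alpha}|L|^{1/2}|A|^{1/2}|B|^{1/2}.$$ In addition, if $L$ is also allowed to contain lines of the form $y=c$ or $x=c$ (with $L_x=\{a : y=ax+b\in L \text{ for some } b\}$ and the same assumption $|L||A|>q^{\alpha}\max\{|A|,|L_x|\}$), then $$I(A\times B,L)\ll \frac{|L||A||B|^{1/2}}{q^{\alpha/2}}+q^{\alpha}|L|^{1/2}|A|^{1/2}|B|^{1/2}+2|A||B|.$$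
   Context: $\mathbb{F}_q$ is the finite field with $q$ elements, $q$ a prime power. For a point set $P$ and a line set $L$ in $\mathbb{F}_q^2$, $I(P,L)$ is the number of incidences, i.e. of pairs $(p,\ell)\in P\times L$ with $p\in\ell$. The notation $f\ll g$ means $f=O(g)$, i.e. $f\le Cg$ with an absolute constant $C>0$ (independent of $q$, $\alpha$ and the sets). *)

(* Defs.v *)
From HB Require Import structures.
From mathcomp Require Import all_boot all_order all_algebra.
From mathcomp Require Import reals exp.

Set Implicit Arguments.
Unset Strict Implicit.
Unset Printing Implicit Defensive.

Import Order.TTheory GRing.Theory Num.Theory.
Local Open Scope ring_scope.

(* Lines of the affine plane over F are represented by their point sets. *)

Definition affine_line (F : finFieldType) (a b : F) : {set F * F} :=
  [set p | p.2 == a * p.1 + b].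

Definition vertical_line (F : finFieldType) (c : F) : {set F * F} :=
  [set p | p.1 == c].

Definition is_slanted_line (F : finFieldType) (l : {set F * F}) : Prop :=
  exists a b : F, a != 0 /\ l = affine_line a b.

(* The line y = c is [affine_line 0 c]. *)
Definition is_axis_parallel_line (F : finFieldType) (l : {set F * F}) : Prop :=
  exists c : F, l = affine_line 0 c \/ l = vertical_line c.

(* The set written L_x; the slope 0 belongs to it when L contains a horizontal
   line, and vertical lines contribute nothing. *)
Definition slopes (F : finFieldType) (L : {set {set F * F}}) : {set F} :=
  [set a | [exists b, affine_line a b \in L]].

Definition incidences (F : finFieldType) (P : {set F * F})
    (L : {set {set F * F}}) : nat :=
  #|[set pl : (F * F) * {set F * F} |
      [&& pl.1 \in P, pl.2 \in L & pl.1 \in pl.2]]|.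

(* Main.v *)
(** Cauchy-Schwarz over the heights [y] in B bounds the square of the number of
    incidences by [|B|] times the number of solutions of
    [a x + b = a' x' + b'] with [(a, b), (a', b')] in L and [x, x'] in A. This
    energy counts incidences between [N = |L||A|] points [(a, x', b)] and N
    planes indexed by [((a', b'), x)]. Three non-collinear points lie on at
    most one plane, and a line of such a plane carries at most
    [k = max(|A|, |L_x|)] points, so the third moment of the number of points
    per plane is at most [N^3] plus [k + 1] times the second one. As
    [k <= N / q^alpha], the energy is at most [9 N (N / q^alpha + q^(2 alpha))].
    Horizontal lines need no separate treatment, and vertical lines account for
    at most [|A||B|] incidences. *)
Require Import Defs.
From HB Require Import structures.
From mathcomp Require Import all_boot all_order all_algebra.
From mathcomp Require Import reals exp.
From mathcomp Require Import ring lra.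

Set Implicit Arguments.
Unset Strict Implicit.
Unset Printing Implicit Defensive.

Import Order.TTheory GRing.Theory Num.Theory.
Local Open Scope ring_scope.

(** * Cauchy-Schwarz and the coefficients of a line *)

Lemma sum_sqr_le (T : finType) (B : {set T}) (r : T -> nat) :
  ((\sum_(y in B) r y) ^ 2 <= #|B| * \sum_(y in B) r y ^ 2)%N.
Proof.
(* Doubling allows [2 u v <= u ^ 2 + v ^ 2] to be summed over all pairs [(y, z)]. *)
rewrite -(@leq_pmul2l 2) // expnS expn1 big_distrlr /= big_distrr /=.
have -> : (2 * (#|B| * \sum_(y in B) r y ^ 2) =
           \sum_(y in B) \sum_(z in B) (r y ^ 2 + r z ^ 2))%N.
  under [in RHS]eq_bigr do rewrite big_split /= sum_nat_const.
  by rewrite big_split /= sum_nat_const -big_distrr /= addnn mul2n.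
apply: leq_sum => y _; rewrite big_distrr /=; apply: leq_sum => z _.
exact: nat_Cauchy.
Qed.

Lemma affine_line_inj (F : finFieldType) (a b c d : F) :
  affine_line a b = affine_line c d -> (a, b) = (c, d).
Proof.
move=> e; have h x : a * x + b = c * x + d.
  have : (x, a * x + b) \in affine_line c d by rewrite -e inE.
  by rewrite inE => /eqP.
have bd : b = d by have := h 0; rewrite !mulr0 !add0r.
by have := h 1; rewrite !mulr1 bd => /addIr ->.
Qed.

(** * Point-plane incidences in 3-space *)

Section PointPlane.
Variables (F : finFieldType) (S : {set F * F}) (A : {set F}) (k : nat).
Hypothesis card_A : (#|A| <= k)%N.
Hypothesis card_slopes : (#|[set l.1 | l in S]| <= k)%N.

Notation point := ((F * F) * F)%type.
Let P : {set point} := setX S A.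

(* [p = ((a, b), x)] is the point [(a, x, b)] of the 3-space over F, and
   [pi = ((a', b'), x')] is the plane [x' * X - a' * Y + Z = b']. *)
Definition plane_eqn (pi p : point) : F :=
  p.1.1 * pi.2 + p.1.2 - (pi.1.1 * p.2 + pi.1.2).

Definition plane_points (pi : point) : {set point} :=
  [set p in P | plane_eqn pi p == 0].

(* The planes above project bijectively to the (X, Y) coordinates, so that
   coplanar points are collinear when their projections are. *)
Definition area (p q r : point) : F :=
  (q.1.1 - p.1.1) * (r.2 - p.2) - (r.1.1 - p.1.1) * (q.2 - p.2).

(** Cramer's rule: subtracting the equation at [p] from those at [q] and [r] eliminates [b'] and
    leaves a linear system for [x'] and [a'] whose determinant is [area p q r] up to sign. The
    equation at [p] then gives [b']. *)
Lemma plane_through_uniq p q r pi pi' : area p q r != 0 ->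
  p \in plane_points pi :&: plane_points pi' ->
  q \in plane_points pi :&: plane_points pi' ->
  r \in plane_points pi :&: plane_points pi' -> pi = pi'.
Proof.
move=> D; rewrite !inE.
move=> /andP[/andP[_ /eqP p0] /andP[_ /eqP p0']].
move=> /andP[/andP[_ /eqP q0] /andP[_ /eqP q0']].
move=> /andP[/andP[_ /eqP r0] /andP[_ /eqP r0']].
pose dq := (plane_eqn pi q - plane_eqn pi p)
           - (plane_eqn pi' q - plane_eqn pi' p).
pose dr := (plane_eqn pi r - plane_eqn pi p)
           - (plane_eqn pi' r - plane_eqn pi' p).
have dq0 : dq = 0 by rewrite /dq p0 p0' q0 q0' !subrr.
have dr0 : dr = 0 by rewrite /dr p0 p0' r0 r0' !subrr.
have ex : pi.2 = pi'.2.
  apply: (mulfI D); apply: subr0_eq.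
  rewrite (_ : _ - _ = (r.2 - p.2) * dq - (q.2 - p.2) * dr).
    by rewrite dq0 dr0 !mulr0 subrr.
  by rewrite /area /dq /dr /plane_eqn; ring.
have ea : pi.1.1 = pi'.1.1.
  apply: (mulfI D); apply: subr0_eq.
  rewrite (_ : _ - _ = (r.1.1 - p.1.1) * dq - (q.1.1 - p.1.1) * dr).
    by rewrite dq0 dr0 !mulr0 subrr.
  by rewrite /area /dq /dr /plane_eqn; ring.
have eb : pi.1.2 = pi'.1.2.
  apply: subr0_eq.
  rewrite (_ : _ - _ = plane_eqn pi' p - plane_eqn pi p).
    by rewrite p0 p0' subrr.
  by rewrite /plane_eqn ex ea; ring.
by case: pi pi' ex ea eb {D p0 p0' q0 q0' r0 r0' dq dr dq0 dr0}
  => [[a b] x] [[a' b'] x'] /= -> -> ->.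
Qed.

Lemma plane_points_inj pi :
  {in plane_points pi &, forall p q, p.1.1 = q.1.1 -> p.2 = q.2 -> p = q}.
Proof.
move=> p q; rewrite !inE => /andP[_ /eqP p0] /andP[_ /eqP q0] e1 e3.
have e2 : p.1.2 = q.1.2.
  apply: subr0_eq; rewrite (_ : _ - _ = plane_eqn pi p - plane_eqn pi q).
    by rewrite p0 q0 subrr.
  by rewrite /plane_eqn e1 e3; ring.
by case: p q e1 e2 e3 {p0 q0} => [[a b] x] [[a' b'] x'] /= -> -> ->.
Qed.

(** On the line through [p] and [q] one coordinate determines the point: the abscissa, with [#|A|]
    values, when [p] and [q] have the same slope coordinate, and the slope coordinate otherwise. *)
Lemma card_collinear pi p q : p \in plane_points pi -> q \in plane_points pi ->
  p != q -> (#|[set r in plane_points pi | area p q r == 0%R]| <= k)%N.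
Proof.
move=> p_pi q_pi neq.
have area_sub r s : area p q r - area p q s =
    (q.1.1 - p.1.1) * (r.2 - s.2) - (q.2 - p.2) * (r.1.1 - s.1.1).
  by rewrite /area; ring.
have [e1|n1] := eqVneq (q.1.1 - p.1.1) 0.
  have n3 : q.2 - p.2 != 0.
    apply: contra neq; rewrite subr_eq0 => /eqP e3; apply/eqP.
    by apply: (plane_points_inj p_pi q_pi) => //; apply/esym/subr0_eq.
  apply: leq_trans card_A; rewrite -(card_in_imset (f := snd)).
    apply/subset_leq_card/subsetP => _ /imsetP[r + ->].
    by rewrite !inE => /andP[/andP[/andP[]]].
  move=> r s /setIdP[r_pi /eqP Dr] /setIdP[s_pi /eqP Ds] e3.
  apply: (plane_points_inj r_pi s_pi) => //; apply: subr0_eq; apply: (mulfI n3).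
  have := area_sub r s; rewrite Dr Ds e1 mul0r mulr0 subrr sub0r.
  by move/esym/eqP; rewrite oppr_eq0 => /eqP.
apply: leq_trans card_slopes; rewrite -(card_in_imset (f := fun r => r.1.1)).
  apply/subset_leq_card/subsetP => _ /imsetP[r + ->].
  rewrite !inE => /andP[/andP[/andP[rS _] _] _].
  by apply/imsetP; exists r.1.
move=> r s /setIdP[r_pi /eqP Dr] /setIdP[s_pi /eqP Ds] e1.
apply: (plane_points_inj r_pi s_pi) => //; apply: subr0_eq; apply: (mulfI n1).
have := area_sub r s.
by rewrite Dr Ds e1 !subrr !mulr0 subr0 => <-.
Qed.

Lemma sum_collinear pi :
  (\sum_(p in plane_points pi) \sum_(q in plane_points pi)
     \sum_(r in plane_points pi) (area p q r == 0%R)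
   <= k.+1 * #|plane_points pi| ^ 2)%N.
Proof.
set N := plane_points pi.
rewrite expnS expn1 mulnCA -sum_nat_const; apply: leq_sum => p pN.
(* For [q = p] every [r] has zero area; this degenerate term accounts for the extra 1 in [k.+1]. *)
rewrite (bigD1 p) //= mulSn leq_add //.
  by rewrite -sum1_card leq_sum // => r _; case: (_ == _).
apply: (@leq_trans (\sum_(q in N | q != p) k)%N).
  apply: leq_sum => q /andP[qN nqp].
  rewrite -big_mkcondr sum1dep_card; apply: card_collinear => //.
  by rewrite eq_sym.
rewrite sum_nat_const mulnC leq_mul2l; apply/orP; right.
by apply/subset_leq_card/subsetP => q /andP[].
Qed.

(** Exchanging the sums, each of the [#|P| ^ 3] triples is counted for at most one plane. *)
Lemma sum_noncollinear :
  (\sum_(pi in P) \sum_(p in plane_points pi) \sum_(q in plane_points pi)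
     \sum_(r in plane_points pi) (area p q r != 0%R) <= #|P| ^ 3)%N.
Proof.
pose X : {set point * point * point} := setX (setX P P) P.
have -> : (#|P| ^ 3 = #|X|)%N by rewrite /X !cardsX !expnS expn0 muln1 mulnA.
pose Y pi (t : point * point * point) :=
  [&& t.1.1 \in plane_points pi, t.1.2 \in plane_points pi &
      t.2 \in plane_points pi].
pose D (t : point * point * point) := area t.1.1 t.1.2 t.2 != 0.
have -> : (\sum_(pi in P) \sum_(p in plane_points pi)
    \sum_(q in plane_points pi) \sum_(r in plane_points pi)
      (area p q r != 0%R) = \sum_(pi in P) \sum_(t | Y pi t) D t)%N.
  apply: eq_bigr => pi _; rewrite pair_big pair_big /=.
  by apply: eq_bigl => t; rewrite /Y andbA.
have YX pi t : Y pi t -> t \in X.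
  case: t => [[p q] r] /and3P[/setIdP[pP _] /setIdP[qP _] /setIdP[rP _]].
  by rewrite !in_setX pP qP rP.
rewrite (exchange_big_dep (mem X)) /=; last by move=> pi t _; exact: YX.
rewrite -sum1_card; apply: leq_sum => t _.
rewrite -big_mkcondr /= sum1dep_card; apply/card_le1_eqP => pi pi'.
rewrite !in_set => /andP[/andP[_ /and3P[h1 h2 h3]] Dt].
move=> /andP[/andP[_ /and3P[h1' h2' h3']] _].
by apply: (plane_through_uniq Dt); apply/setIP.
Qed.

Lemma third_moment :
  (\sum_(pi in P) #|plane_points pi| ^ 3 <=
   #|P| ^ 3 + k.+1 * \sum_(pi in P) #|plane_points pi| ^ 2)%N.
Proof.
rewrite big_distrr /=.
have collinear := @leq_sum _ (index_enum _) (mem P) _ _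
  (fun pi _ => sum_collinear pi).
apply: leq_trans (leq_add sum_noncollinear collinear).
rewrite -big_split; apply: leq_sum => pi _ /=.
rewrite -big_split /= !expnS expn0 muln1 -sum_nat_const leq_sum // => p _.
rewrite -big_split /= -sum_nat_const leq_sum // => q _.
rewrite -big_split /= -sum1_card leq_sum // => r _.
by case: (_ == _).
Qed.

Lemma energy_le (R : realFieldType) (U : R) : (0 < k)%N -> k%:R <= U ->
  #|P|%:R ^+ 2 <= U ^+ 3 ->
  (\sum_(pi in P) #|plane_points pi|)%:R <= 9 * U * #|P|%:R.
Proof.
move=> k_gt0 kU PU.
have U1 : 1 <= U by apply: le_trans kU; rewrite ler1n.
have kU2 : k.+1%:R <= 2 * U :> R by rewrite -natr1; lra.
(* [n^3 - 2 U n^2 - 8 U^2 n + 64 U^3 > 0]: points on planes poorer than about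
   [U] cost [8 U] each, and the third moment pays for the rich planes. *)
have pointwise (n : nat) :
    8 * U ^+ 2 * n%:R + k.+1%:R * n%:R ^+ 2 <= 64 * U ^+ 3 + n%:R ^+ 3 :> R.
  have n0 : 0 <= n%:R :> R by [].
  have h : k.+1%:R * n%:R ^+ 2 <= 2 * U * n%:R ^+ 2.
    by rewrite ler_wpM2r // exprn_ge0.
  (* The cubic is [n (n - 3 U)^2 + U (2 n - 17/4 U)^2 + (64 - 289/16) U^3], a sum of nonnegative
     terms. *)
  have h1 : 0 <= n%:R * (n%:R - 3 * U) ^+ 2 by rewrite mulr_ge0 ?sqr_ge0.
  have h2 : 0 <= U * (2 * n%:R - 17 / 4 * U) ^+ 2.
    by rewrite mulr_ge0 ?sqr_ge0 //; lra.
  have h3 : 0 <= U ^+ 3 by rewrite exprn_ge0 //; lra.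
  move: h1 h2; rewrite !sqrrB => h1 h2; nra.
have S3 : \sum_(pi in P) #|plane_points pi|%:R ^+ 3 <= #|P|%:R ^+ 3
    + k.+1%:R * \sum_(pi in P) #|plane_points pi|%:R ^+ 2 :> R.
  under eq_bigr do rewrite -natrX.
  under [X in _ + _ * X]eq_bigr do rewrite -natrX.
  by rewrite -!natr_sum -natrX -natrM -natrD ler_nat third_moment.
have : \sum_(pi in P) (8 * U ^+ 2 * #|plane_points pi|%:R
                       + k.+1%:R * #|plane_points pi|%:R ^+ 2)
     <= \sum_(pi in P) (64 * U ^+ 3 + #|plane_points pi|%:R ^+ 3).
  by apply: ler_sum => pi _; exact: pointwise.
rewrite !big_split /= -!mulr_sumr sumr_const -mulr_natr -natr_sum.
set E := (\sum_(pi in P) _)%:R => le_sums.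
(* The second moments cancel between [le_sums] and [S3], leaving [8 U^2 E <= 64 U^3 #|P| + #|P|^3].
   The right side is at most [65 U^3 #|P|], below the required [72 U^3 #|P|]. *)
have NU : #|P|%:R ^+ 3 <= #|P|%:R * U ^+ 3 :> R by rewrite exprS ler_wpM2l.
have U2 : 0 < 8 * U ^+ 2 by rewrite mulr_gt0 // exprn_gt0 //; lra.
have NU0 : 0 <= #|P|%:R * U ^+ 3 by rewrite mulr_ge0 // exprn_ge0 //; lra.
rewrite -(ler_pM2l U2).
have -> : 8 * U ^+ 2 * (9 * U * #|P|%:R) = 72 * (#|P|%:R * U ^+ 3) by ring.
have h : 64 * U ^+ 3 * #|P|%:R = 64 * (#|P|%:R * U ^+ 3) by ring.
by lra.
Qed.

(** * From incidences at equal heights to the energy *)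

Definition height (p : point) : F := p.1.1 * p.2 + p.1.2.

Lemma sum_height_sqr (B : {set F}) :
  (\sum_(y in B) #|[set p in P | height p == y]| ^ 2
   <= \sum_(pi in P) #|plane_points pi|)%N.
Proof.
have -> : (\sum_(pi in P) #|plane_points pi| =
    \sum_(pq in setX P P) (height pq.1 == height pq.2))%N.
  transitivity (\sum_(pi in P) \sum_(p in P) (plane_eqn pi p == 0%R))%N.
    by apply: eq_bigr => pi _; rewrite -big_mkcondr sum1dep_card.
  rewrite pair_big /=.
  (* [plane_eqn pi p] is the height of [(p.1, pi.2)] minus that of [(pi.1, p.2)], so exchanging
     abscissas turns point-plane incidences into pairs of equal height. *)
  pose swap (u : point * point) := ((u.1.1, u.2.2), (u.2.1, u.1.2)).
  have swapK : involutive swap by move=> [[l x] [l' x']].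
  rewrite (reindex_inj (inv_inj swapK)) /=; apply: eq_big.
    move=> [[l x] [l' x']]; rewrite !inE /= andbACA [RHS]andbACA.
    by rewrite [(x' \in A) && _]andbC.
  move=> [[l x] [l' x']] _; rewrite /plane_eqn /height /= subr_eq0.
  by rewrite eq_sym.
have -> : (\sum_(y in B) #|[set p in P | height p == y]| ^ 2 =
    \sum_(y in B) \sum_(pq | (pq \in setX P P)
        && ((height pq.1 == y) && (height pq.2 == y))) 1)%N.
  apply: eq_bigr => y _; rewrite expnS expn1 -cardsX -sum1_card.
  by apply: eq_bigl => [[p q]]; rewrite !inE /= andbACA.
rewrite (exchange_big_dep (mem (setX P P))) /=; last by move=> y pq _ /andP[].
apply: leq_sum => pq _; case: (eqVneq (height pq.1) (height pq.2)) => [<-|ne] /=.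
  rewrite sum1dep_card; apply/card_le1_eqP => y y'.
  by rewrite !in_set => /and4P[_ _ /eqP <- _] /and4P[_ _ /eqP <- _].
rewrite big1 // => y /and4P[_ _ /eqP e1 /eqP e2].
by rewrite e1 e2 eqxx in ne.
Qed.

Lemma card_height_in (B : {set F}) :
  (#|[set p in P | height p \in B]| ^ 2
   <= #|B| * \sum_(pi in P) #|plane_points pi|)%N.
Proof.
have -> : (#|[set p in P | height p \in B]| =
    \sum_(y in B) #|[set p in P | height p == y]|)%N.
  rewrite -sum1_card (partition_big height (mem B)) /=; last first.
    by move=> p; rewrite inE => /andP[].
  apply: eq_bigr => y yB; rewrite -sum1_card; apply: eq_bigl => p.
  rewrite !in_set; case: (eqVneq (height p) y) => [->|_]; last by rewrite !andbF.
  by rewrite yB andbT.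
by apply: leq_trans (sum_sqr_le _ _) _; rewrite leq_mul2l sum_height_sqr orbT.
Qed.

End PointPlane.

(** * Incidences of lines with the grid *)

Lemma incidences_nonvertical (R : realFieldType) (F : finFieldType)
    (A B : {set F}) (L : {set {set F * F}}) (k : nat) (U : R) :
  (forall l, l \in L -> exists a b, l = affine_line a b) ->
  (0 < k)%N -> (#|A| <= k)%N -> (#|slopes L| <= k)%N -> k%:R <= U ->
  (#|L| * #|A|)%:R ^+ 2 <= U ^+ 3 ->
  (incidences (setX A B) L)%:R ^+ 2 <= 9 * U * (#|L| * #|A|)%:R * #|B|%:R.
Proof.
move=> L_nv k_gt0 Ak Sk kU LU.
pose S : {set F * F} := [set ab | affine_line ab.1 ab.2 \in L].
have SL : #|S| = #|L|.
  rewrite -(card_imset (f := fun ab : F * F => affine_line ab.1 ab.2)).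
    apply: eq_card => l; apply/imsetP/idP => [[ab + ->]|lL].
      by rewrite inE.
    have [a [b e]] := L_nv l lL; exists (a, b) => //.
    by rewrite inE /= -e.
  by move=> [a b] [c d] /affine_line_inj.
have S_slopes : (#|[set l.1 | l in S]| <= k)%N.
  apply: leq_trans Sk; apply/subset_leq_card/subsetP => _ /imsetP[[a b] + ->].
  by rewrite !inE /= => h; apply/existsP; exists b.
have PE : #|setX S A| = (#|L| * #|A|)%N by rewrite cardsX SL.
rewrite -PE; rewrite -PE in LU.
have I_le : (incidences (setX A B) L
             <= #|[set p in setX S A | height p \in B]|)%N.
  (* On a nonvertical line an incidence is recovered from the coefficients of the line and the
     abscissa of the point. *)
  rewrite -(card_in_imset (f := fun p : (F * F) * F =>
    ((p.2, height p), affine_line p.1.1 p.1.2))); last first.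
    move=> [[a b] x] [[c d] y] _ _ /= [-> _ /affine_line_inj [-> ->]] //.
  apply/subset_leq_card/subsetP => [[[x y] l]]; rewrite !inE /=.
  move=> /and3P[/andP[xA yB] lL]; have [a [b e]] := L_nv l lL.
  rewrite e inE /= => /eqP yE; apply/imsetP; exists ((a, b), x) => /=.
    by rewrite !inE /= -e lL xA /height /= -yE yB.
  by rewrite /height /= -yE.
have : (incidences (setX A B) L ^ 2
        <= #|B| * \sum_(pi in setX S A) #|plane_points S A pi|)%N.
  by apply: leq_trans (card_height_in S A B); rewrite leq_exp2r.
rewrite -(ler_nat R) natrX natrM => /le_trans; apply.
by rewrite mulrC ler_wpM2r // (energy_le Ak S_slopes).
Qed.

(** Distinct vertical lines are disjoint, so a point determines the one through it. *)
Lemma incidences_vertical (F : finFieldType) (P : {set F * F})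
    (L : {set {set F * F}}) :
  (forall l, l \in L -> exists c, l = vertical_line c) ->
  (incidences P L <= #|P|)%N.
Proof.
move=> L_v; rewrite /incidences -(card_in_imset (f := fst)).
  by apply/subset_leq_card/subsetP => _ /imsetP[pl + ->]; rewrite inE => /and3P[].
move=> [p l] [p' l']; rewrite !inE /= => /and3P[_ lL pl] /and3P[_ lL' pl'] e.
move: pl pl'; have [c ->] := L_v l lL; have [c' ->] := L_v l' lL'.
by rewrite -e !inE => /eqP-> /eqP->.
Qed.

Lemma incidencesU (F : finFieldType) (P : {set F * F})
    (L1 L2 : {set {set F * F}}) :
  (incidences P (L1 :|: L2) <= incidences P L1 + incidences P L2)%N.
Proof.
apply: leq_trans (leq_card_setU _ _); apply/subset_leq_card/subsetP => pl.
by rewrite !inE => /and3P[-> /orP[]-> ->]; rewrite ?orbT.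
Qed.

Lemma slopesS (F : finFieldType) (L1 L2 : {set {set F * F}}) :
  L1 \subset L2 -> slopes L1 \subset slopes L2.
Proof.
move=> /subsetP sL; apply/subsetP => a; rewrite !inE => /existsP[b /sL h].
by apply/existsP; exists b.
Qed.

(* [(N / Q)^2 * Q^2] is a term of the expanded cube. *)
Lemma sqr_le_threshold (R : realFieldType) (N Q : R) : 0 <= N -> 0 < Q ->
  N ^+ 2 <= (N / Q + Q ^+ 2) ^+ 3.
Proof.
move=> N0 Q0; set x := N / Q; have x0 : 0 <= x by rewrite divr_ge0 // ltW.
have e : N = x * Q by rewrite /x mulfVK // gt_eqF.
have y0 : 0 <= Q ^+ 2 by rewrite sqr_ge0.
rewrite e exprMn; move: {e} x (Q ^+ 2) x0 y0 => x y x0 y0.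
have -> : (x + y) ^+ 3 = x ^+ 2 * y
    + (x ^+ 3 + 2 * (x ^+ 2 * y) + 3 * (x * y ^+ 2) + y ^+ 3) by ring.
by rewrite lerDl !(addr_ge0, mulr_ge0, exprn_ge0).
Qed.

(** The size assumption concerns all of [L] while only [L'] is counted: removing vertical lines
    could destroy the assumption, whereas the bounds on [k] and [N] pass to subsets. *)
Lemma incidences_nonvertical_part (R : realType) (F : finFieldType)
    (A B : {set F}) (L L' : {set {set F * F}}) (alpha : R) :
  L' \subset L -> (forall l, l \in L' -> exists a b, l = affine_line a b) ->
  #|L|%:R * #|A|%:R > #|F|%:R `^ alpha * Num.max #|A|%:R #|slopes L|%:R ->
  (incidences (setX A B) L')%:R <=
    3 * (#|L|%:R * #|A|%:R * Num.sqrt #|B|%:R / #|F|%:R `^ (alpha / 2)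
         + #|F|%:R `^ alpha * Num.sqrt #|L|%:R * Num.sqrt #|A|%:R
           * Num.sqrt #|B|%:R).
Proof.
move=> L'L L'_nv.
have q0 : 0 < #|F|%:R :> R by rewrite ltr0n; apply/card_gt0P; exists 0.
have Q0 : 0 < #|F|%:R `^ alpha by rewrite powR_gt0.
have s0 : 0 < #|F|%:R `^ (alpha / 2) by rewrite powR_gt0.
have s2 : (#|F|%:R `^ (alpha / 2)) ^+ 2 = #|F|%:R `^ alpha.
  by rewrite -powR_mulrn ?powR_ge0 // -powRrM mulfVK // pnatr_eq0.
move: s0 s2 Q0; set s := _ `^ (alpha / 2); set Q := _ `^ alpha => s0 s2 Q0.
set k := maxn #|A| #|slopes L|.
have -> : Num.max #|A|%:R #|slopes L|%:R = k%:R :> R by rewrite /k natr_max.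
rewrite -natrM; set N := (#|L| * #|A|)%N => kN.
have N0 : 0 <= N%:R :> R by [].
have k_gt0 : (0 < k)%N.
  have : 0 < N%:R :> R by apply: le_lt_trans kN; rewrite mulr_ge0 // ltW.
  rewrite ltr0n muln_gt0 => /andP[_ A0].
  by rewrite (leq_trans A0) // leq_maxl.
(* The first term dominates [k] by the size assumption; adding the second makes [U ^+ 3] dominate
   [N ^+ 2]. *)
pose U := N%:R / Q + Q ^+ 2.
have kU : k%:R <= U.
  apply: le_trans (_ : N%:R / Q <= U); last by rewrite lerDl sqr_ge0.
  by rewrite ler_pdivlMr // mulrC ltW.
have N'N : (#|L'| * #|A|)%:R <= N%:R :> R.
  by rewrite ler_nat leq_mul2r subset_leq_card ?orbT.
have U0 : 0 <= U by apply: le_trans kU.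
have N'U : (#|L'| * #|A|)%:R ^+ 2 <= U ^+ 3.
  apply: le_trans (sqr_le_threshold N0 Q0).
  by rewrite ler_pXn2r // nnegrE.
have Sk : (#|slopes L'| <= k)%N.
  by rewrite (leq_trans (subset_leq_card (slopesS L'L))) // leq_maxr.
have := incidences_nonvertical B L'_nv k_gt0 (leq_maxl _ _) Sk kU N'U.
set I := (incidences _ _)%:R => I2.
set X := _ / s; set Y := _ * Num.sqrt _.
have X0 : 0 <= X by rewrite divr_ge0 ?mulr_ge0 ?sqrtr_ge0 // ltW.
have Y0 : 0 <= Y by rewrite !mulr_ge0 ?sqrtr_ge0 // ltW.
have X2 : X ^+ 2 = N%:R ^+ 2 / Q * #|B|%:R.
  by rewrite /X !exprMn exprVn s2 sqr_sqrtr // mulrAC.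
have Y2 : Y ^+ 2 = Q ^+ 2 * N%:R * #|B|%:R.
  by rewrite /Y !exprMn !sqr_sqrtr // /N natrM !mulrA.
rewrite -(@ler_pXn2r _ 2) ?nnegrE //; last by rewrite mulr_ge0 // addr_ge0.
apply: le_trans I2 _.
(* The two terms of [U] yield exactly [9 X^2] and [9 Y^2], whence the constant 3; the cross term is
   nonnegative. *)
have -> : (3 * (X + Y)) ^+ 2 = 9 * (X ^+ 2 + Y ^+ 2) + 18 * (X * Y) by ring.
have -> : 9 * (X ^+ 2 + Y ^+ 2) = 9 * U * N%:R * #|B|%:R.
  by rewrite X2 Y2 /U; ring.
apply: le_trans (_ : _ <= 9 * U * N%:R * #|B|%:R) _.
  by rewrite ler_wpM2r // ler_wpM2l // mulr_ge0.
by rewrite lerDl mulr_ge0 // mulr_ge0.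
Qed.

Theorem theorem1p2 (R : realType) :
  (exists C : R, 0 < C /\
    forall (F : finFieldType) (A B : {set F}) (L : {set {set F * F}})
           (alpha : R),
      0 < alpha -> alpha < 1 ->
      (forall l, l \in L -> is_slanted_line l) ->
      #|L|%:R * #|A|%:R >
        #|F|%:R `^ alpha * Num.max #|A|%:R #|slopes L|%:R ->
      (incidences (setX A B) L)%:R <=
        C * (#|L|%:R * #|A|%:R * Num.sqrt #|B|%:R / #|F|%:R `^ (alpha / 2)
             + #|F|%:R `^ alpha * Num.sqrt #|L|%:R * Num.sqrt #|A|%:R
               * Num.sqrt #|B|%:R))
  /\
  (exists C : R, 0 < C /\
    forall (F : finFieldType) (A B : {set F}) (L : {set {set F * F}})
           (alpha : R),
      0 < alpha -> alpha < 1 ->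
      (forall l, l \in L -> is_slanted_line l \/ is_axis_parallel_line l) ->
      #|L|%:R * #|A|%:R >
        #|F|%:R `^ alpha * Num.max #|A|%:R #|slopes L|%:R ->
      (incidences (setX A B) L)%:R <=
        C * (#|L|%:R * #|A|%:R * Num.sqrt #|B|%:R / #|F|%:R `^ (alpha / 2)
             + #|F|%:R `^ alpha * Num.sqrt #|L|%:R * Num.sqrt #|A|%:R
               * Num.sqrt #|B|%:R
             + 2 * #|A|%:R * #|B|%:R)).
Proof.
split; exists 3; split=> // F A B L alpha _ _ L_type LA.
  apply: incidences_nonvertical_part LA => // l /L_type[a [b [_ ->]]].
  by exists a, b.
(* Only vertical lines are split off; their at most [#|A| * #|B|] incidences fit in the last term of
   the bound. *)
pose V := [set l : {set F * F} | [exists c, l == vertical_line c]].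
have V_v l : l \in L :&: V -> exists c, l = vertical_line c.
  by rewrite !inE => /andP[_ /existsP[c /eqP ->]]; exists c.
have nV l : l \in L :\: V -> exists a b, l = affine_line a b.
  rewrite !inE => /andP[+ lL].
  have [[a [b [_ ->]]]|[c [->|->]]] := L_type l lL.
  - by exists a, b.
  - by exists 0, c.
  - by move/existsP => []; exists c.
have := incidences_nonvertical_part B (subsetDl L V) nV LA.
have := incidencesU (setX A B) (L :\: V) (L :&: V).
rewrite setUC setID -(ler_nat R) natrD => IU.
have := incidences_vertical (setX A B) V_v.
rewrite -(ler_nat R) cardsX natrM => IV.
have : 0 <= #|A|%:R * #|B|%:R :> R by rewrite mulr_ge0.
by rewrite -mulrA; lra.
Qed.
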